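(* Suppose that $E(Y^2)<\infty$, $E(\|X\|^2)<\infty$, $V(Y)>0$, $V(X)$ is non-singular, and $E(Y|X)=\alpha_0+X'\beta_0$ for some $(\alpha_0,\beta_0)\in\mathbb{R}\times\mathbb{R}^p$. Let $\phi:\mathbb{R}\to\mathbb{R}$ be a convex function such that $E[\phi(Y)]<\infty$. Then: 1. If for all $\beta\in\mathbb{R}^p$, $\beta\neq 0_p$, $E[\phi(X'\beta)]=\infty$, then $\mathcal{B}=\{\beta_0\}=\{0_p\}$. 2. If $E[\phi(X_1\beta_1)]=\infty$ for all real $\beta_1\ne0$ and $E[\phi(X_{-1}'\beta_{-1})]<\infty$ for all $\beta_{-1}\in\mathbb{R}^{p-1}$, then $\mathcal{B}_1=\{\beta_{0,1}\}=\{0\}$.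
   Context: $Y$ is a real random variable and $X=(X_1,X_{-1}')'$ a random vector in $\mathbb{R}^p$, with $X_1$ its first component and $X_{-1}\in\mathbb{R}^{p-1}$ the remaining ones; $\beta_{0,1}$ is the first component of $\beta_0$. $V(\cdot)$ is the variance (matrix), $0_p$ the zero vector, $\overset{d}{=}$ equality in distribution, and $A_0:=A-E(A)$ for integrable $A$. For a convex function $\phi$ and integrable $A$, $E[\phi(A)]\in(-\infty,\infty]$ is always well-defined. Only the marginal distributions of $Y$ and of $X$ are known; the identified set of $\beta_0$ is $$\mathcal{B}=\left\{\beta\in\mathbb{R}^p:\ \exists\text{ random variables }(\widetilde X,\widetilde Y):\ E(\widetilde Y_0|\widetilde X_0)=\widetilde X_0'\beta,\ \widetilde X\overset{d}{=}X,\ \widetilde Y\overset{d}{=}Y\right\},$$ and the identified set of $\beta_{0,1}$ is $\mathcal{B}_1=\{b_1:\ \exists\beta\in\mathcal{B}\text{ with first component }b_1\}$. *)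

(* Defs.v *)
From HB Require Import structures.
From mathcomp Require Import all_boot all_order all_algebra.
From mathcomp Require Import all_classical all_reals all_analysis.

Set Implicit Arguments.
Unset Strict Implicit.
Unset Printing Implicit Defensive.

Import Order.TTheory GRing.Theory Num.Theory.
Import numFieldNormedType.Exports.

Local Open Scope classical_set_scope.
Local Open Scope ring_scope.

(* Random vectors take values in [n.-tuple R], on which the library puts the
   product (= Borel) sigma-algebra; coefficient vectors live in ['cV[R]_n]. *)

Definition dot (R : realType) (n : nat) (x : n.-tuple R) (b : 'cV[R]_n) : R :=
  \sum_(i < n) tnth x i * b i ord0.

Definition sqnorm (R : realType) (n : nat) (x : n.-tuple R) : R :=
  \sum_(i < n) tnth x i ^+ 2.

Definition centered d (T : measurableType d) (R : realType)
    (P : probability T R) (Y : T -> R) : T -> R :=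
  fun w => Y w - fine 'E_P[Y].

Definition centered_vec d (T : measurableType d) (R : realType)
    (P : probability T R) (n : nat) (X : T -> n.-tuple R) : T -> n.-tuple R :=
  fun w => [tuple centered P (fun w' => tnth (X w') i) w | i < n].

Definition covariance_mx d (T : measurableType d) (R : realType)
    (P : probability T R) (n : nat) (X : T -> n.-tuple R) : 'M[R]_n :=
  \matrix_(i < n, j < n)
    fine (covariance P (fun w => tnth (X w) i) (fun w => tnth (X w) j)).

(* The two variables may be defined on different probability spaces; the laws
   are compared on measurable sets only, because [distribution] is a function
   on all subsets. *)
Definition eq_distribution d1 d2 d' (T1 : measurableType d1)
    (T2 : measurableType d2) (S : measurableType d') (R : realType)
    (P1 : probability T1 R) (P2 : probability T2 R)
    (X1 : {RV P1 >-> S}) (X2 : {RV P2 >-> S}) : Prop :=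
  forall B : set S, measurable B ->
    distribution P1 X1 B = distribution P2 X2 B.

Definition generated_sigma d d' (T : measurableType d) (S : measurableType d')
    (X : T -> S) : set (set T) :=
  preimage_set_system [set: T] X measurable.

(* E(Y | X) = Z almost surely, i.e. Z is a version of the conditional
   expectation of Y given the sigma-algebra generated by X. *)
Definition cond_expectation_eq d d' (T : measurableType d)
    (S : measurableType d') (R : realType) (P : probability T R)
    (Y : T -> R) (X : T -> S) (Z : T -> R) : Prop :=
  [/\ P.-integrable [set: T] (EFin \o Y),
      P.-integrable [set: T] (EFin \o Z),
      forall B : set R, measurable B -> generated_sigma X (Z @^-1` B) &
      forall A : set T, generated_sigma X A ->
        (\int[P]_(w in A) (Z w)%:E = \int[P]_(w in A) (Y w)%:E)%E].

Definition identified_set d (T : measurableType d) (R : realType)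
    (P : probability T R) (n : nat)
    (X : {RV P >-> n.-tuple R}) (Y : {RV P >-> R}) : set 'cV[R]_n :=
  [set b | exists (d' : measure_display) (T' : measurableType d')
             (P' : probability T' R)
             (X' : {RV P' >-> n.-tuple R}) (Y' : {RV P' >-> R}),
      [/\ cond_expectation_eq P' (centered P' Y') (centered_vec P' X')
            (fun w => dot (centered_vec P' X' w) b),
          eq_distribution X' X & eq_distribution Y' Y]].

Definition identified_set1 d (T : measurableType d) (R : realType)
    (P : probability T R) (q : nat)
    (X : {RV P >-> q.+1.-tuple R}) (Y : {RV P >-> R}) : set R :=
  [set b1 | exists2 b, identified_set X Y b & b ord0 ord0 = b1].

(* Main.v *)
(* If b is in the identified set, there is a coupling with E(Y'|X') = c + X'b.
   By the conditional Jensen inequality, E[phi(c + X'b)] <= E[phi(Y)] < oo, and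
   convexity of phi removes the constant: phi(X'b / 2) is at most
   (phi(c + X'b) + phi(-c)) / 2, hence has finite expectation, and b = 0 follows
   in part 1. In part 2, X_1 b_1 / 4 is the midpoint of X'b / 2 and
   - X_{-1}'b_{-1} / 2, so that phi(X_1 b_1 / 4) has finite expectation too.
   Conversely, (X, Y) itself shows that beta0 is in the identified set.

   Conditional Jensen is obtained without the general theory of conditional
   expectations by writing phi as a countable supremum of affine functions. *)
Require Import Defs.
From HB Require Import structures.
From mathcomp Require Import all_boot all_order all_algebra.
From mathcomp Require Import all_classical all_reals all_analysis.
From mathcomp Require Import measurable_realfun ring lra.

Set Implicit Arguments.
Unset Strict Implicit.
Unset Printing Implicit Defensive.

Import Order.TTheory GRing.Theory Num.Theory.
Import numFieldNormedType.Exports.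

Local Open Scope classical_set_scope.
Local Open Scope ring_scope.

(** * Convex functions as countable suprema of affine functions *)

Lemma convex_functionP (R : realType) (phi : R -> R) :
  @convex_function R R^o [set: R^o] phi ->
  forall t x y, 0 <= t -> t <= 1 ->
    phi (t * x + (1 - t) * y) <= t * phi x + (1 - t) * phi y.
Proof.
by move=> cphi t x y t0 t1; apply: (cphi (Itv01 t0 t1)); rewrite inE.
Qed.

(** Writing [x] as the convex combination of [y] and [z] with weight [(z - x) / (z - y)] on [y]
    turns convexity into this comparison of slopes. *)
Lemma convex_chord (R : realType) (phi : R -> R) (x y z : R) :
  @convex_function R R^o [set: R^o] phi -> y < x -> x < z ->
  (phi x - phi y) / (x - y) <= (phi z - phi x) / (z - x).
Proof.
move=> /convex_functionP cphi yx xz.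
have yz : y < z := lt_trans yx xz.
have t0 : 0 <= (z - x) / (z - y) by apply: divr_ge0; rewrite subr_ge0 ltW.
have t1 : (z - x) / (z - y) <= 1 by rewrite ler_pdivrMr ?subr_gt0//; lra.
have := cphi _ y z t0 t1.
have -> : (z - x) / (z - y) * y + (1 - (z - x) / (z - y)) * z = x.
  by field; rewrite subr_eq0 gt_eqF.
have -> : (z - x) / (z - y) * phi y + (1 - (z - x) / (z - y)) * phi z =
    ((z - x) * phi y + (x - y) * phi z) / (z - y).
  by field; rewrite subr_eq0 gt_eqF.
rewrite ler_pdivlMr ?subr_gt0// => h.
rewrite ler_pdivrMr ?subr_gt0// mulrAC ler_pdivlMr ?subr_gt0//.
nra.
Qed.

(** The slope at [x] is the supremum of the slopes of the chords to the left of [x], i.e. the left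
    derivative. By [convex_chord], any chord to the right bounds these slopes, so the supremum is
    finite and lies below all right slopes. *)
Lemma convex_support_line (R : realType) (phi : R -> R) :
  @convex_function R R^o [set: R^o] phi ->
  exists s : R -> R, forall x y, phi x + s x * (y - x) <= phi y.
Proof.
move=> cphi.
pose S x := [set (phi x - phi y) / (x - y) | y in [set y | y < x]].
have ubS x z : x < z -> ubound (S x) ((phi z - phi x) / (z - x)).
  by move=> xz _ [y /= yx <-]; exact: convex_chord.
have supS x : has_sup (S x).
  split; first by exists ((phi x - phi (x - 1)) / (x - (x - 1))), (x - 1) => //=; lra.
  by exists ((phi (x + 1) - phi x) / (x + 1 - x)); apply: ubS; lra.
exists (fun x => sup (S x)) => x y.
have [yx|xy|->] := ltgtP y x; last lra.
- have : (phi x - phi y) / (x - y) <= sup (S x).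
    by apply: sup_ubound; [case: (supS x)|exists y].
  by rewrite ler_pdivrMr ?subr_gt0//; nra.
- have : sup (S x) <= (phi y - phi x) / (y - x).
    by apply: ge_sup; [case: (supS x)|exact: ubS].
  by rewrite ler_pdivlMr ?subr_gt0//; nra.
Qed.

(** Support lines at rational points suffice: the support line at a rational slightly to the right
    of [x] is nearly exact at [x], since its slope stays bounded. Countability is what later allows
    monotone convergence. *)
Lemma convex_sup_affine (R : realType) (phi : R -> R) :
  @convex_function R R^o [set: R^o] phi ->
  exists a b : R^nat, (forall n x, a n * x + b n <= phi x) /\
    forall x e, 0 < e -> exists n, phi x - e < a n * x + b n.
Proof.
move=> /convex_support_line[s hs].
(* [q] enumerates the rationals; codes that decode to nothing are sent to 0. *)
pose q n : R := ratr (odflt 0%R (unpickle n)).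
exists (fun n => s (q n)), (fun n => phi (q n) - s (q n) * q n); split.
  by move=> n x; have := hs (q n) x; lra.
move=> x e e0.
(* [K] bounds the growth of the slope on [[x, x + 1]]; the added 1 makes it positive, so that a
   rational can be taken within [e / K] of [x]. *)
pose K := `|s (x + 1) - s x| + 1.
have K0 : 0 < K by rewrite /K; have := normr_ge0 (s (x + 1) - s x); lra.
have /rat_in_itvoo[r] : x < x + Num.min 1 (e / K).
  by rewrite ltrDl lt_min ltr01 divr_gt0.
rewrite in_itv/= => /andP[xr]; rewrite -ltrBlDl lt_min => /andP[r1 reK].
exists (pickle r); rewrite /q pickleK/=.
(* Adding the support inequalities at the two points, each evaluated at the other, shows that the
   slopes are monotone. *)
have s_le : s (ratr r) <= s (x + 1).
  have h1 := hs (ratr r) (x + 1); have h2 := hs (x + 1) (ratr r).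
  have : 0 <= (s (x + 1) - s (ratr r)) * (x + 1 - ratr r) by nra.
  by rewrite pmulr_lge0; lra.
have sK : s (x + 1) - s x <= K by rewrite /K; have := ler_norm (s (x + 1) - s x); lra.
have lt_e : (ratr r - x) * K < e by rewrite -ltr_pdivlMr.
(* The support line at [x] bounds [phi (ratr r)] from below, so the line at [ratr r] misses [phi x]
   by at most [(s (ratr r) - s x) * (ratr r - x)], which is less than [e]. *)
have := hs x (ratr r).
have : (s (ratr r) - s x) * (ratr r - x) <= K * (ratr r - x).
  by rewrite ler_pM2r ?subr_gt0//; lra.
nra.
Qed.

(** These maxima over the indices 0 to [n] make the affine minorants a nondecreasing sequence, as
    monotone convergence requires. *)
Fixpoint max_affine (R : realType) (a b : R^nat) (n : nat) (x : R) : R :=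
  if n is m.+1 then Num.max (max_affine a b m x) (a n * x + b n)
  else a 0 * x + b 0.

Section max_affine.
Context (R : realType) (a b : R^nat).

Lemma affine_le_max_affine n x : a n * x + b n <= max_affine a b n x.
Proof. by case: n => [|n] //=; rewrite le_max lexx orbT. Qed.

Lemma nondecreasing_max_affine x : nondecreasing_seq (max_affine a b ^~ x).
Proof. by apply/nondecreasing_seqP => n /=; rewrite le_max lexx. Qed.

Lemma max_affine_le phi n x :
  (forall m y, a m * y + b m <= phi y) -> max_affine a b n x <= phi x.
Proof. by move=> h; elim: n => //= n IHn; rewrite ge_max IHn h. Qed.

Lemma measurable_affine (c e : R) : measurable_fun [set: R] (fun x => c * x + e).
Proof. by apply: measurable_funD => //; exact: measurable_funM. Qed.

Lemma measurable_max_affine n : measurable_fun [set: R] (max_affine a b n).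
Proof.
elim: n => [|n IHn] /=; first exact: measurable_affine.
by apply: measurable_maxr => //; exact: measurable_affine.
Qed.

Lemma cvg_max_affine (phi : R -> R) x :
  (forall n y, a n * y + b n <= phi y) ->
  (forall y e, 0 < e -> exists n, phi y - e < a n * y + b n) ->
  max_affine a b n x @[n --> \oo] --> phi x.
Proof.
move=> le_phi sup_phi; apply/cvgrPdist_lt => e e0.
have [n hn] := sup_phi x _ e0; exists n => // m /= nm.
have := nondecreasing_max_affine x nm; have := affine_le_max_affine n x.
have := max_affine_le m x le_phi => ? ? ?.
by rewrite ger0_norm; lra.
Qed.

End max_affine.

Lemma measurable_convex (R : realType) (phi : R -> R) :
  @convex_function R R^o [set: R^o] phi -> measurable_fun [set: R] phi.
Proof.
move=> /convex_sup_affine[a [b [le_phi sup_phi]]].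
apply: (measurable_fun_cvg (h := max_affine a b)) => [n|x _].
  exact: measurable_max_affine.
exact: cvg_max_affine.
Qed.

(** * Integrability criteria under a probability measure *)

Section integrable.
Context d (T : measurableType d) (R : realType) (P : probability T R).
Implicit Types (Y Z f g : T -> R) (A : set T).

Lemma integrable_affine A Z (a b : R) : measurable A ->
  P.-integrable A (EFin \o Z) ->
  P.-integrable A (EFin \o (fun w => a * Z w + b)).
Proof.
move=> mA iZ.
rewrite (_ : _ \o _ = (fun w => a%:E * (EFin \o Z) w) \+ (EFin \o cst b))%E.
  apply: integrableD => //; first exact: integrableZl.
  exact: finite_measure_integrable_cst.
by apply/funext => w /=; rewrite EFinD EFinM.
Qed.

Lemma integral_affine A Z (a b : R) : measurable A ->
  P.-integrable A (EFin \o Z) ->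
  (\int[P]_(w in A) (a * Z w + b)%:E =
   a%:E * \int[P]_(w in A) (Z w)%:E + b%:E * P A)%E.
Proof.
move=> mA iZ.
under eq_integral do rewrite EFinD EFinM.
rewrite integralD//; last 2 first.
- exact: integrableZl.
- exact: finite_measure_integrable_cst.
by rewrite integralZl// integral_cst.
Qed.

Lemma integrable_squeeze f g h :
  measurable_fun [set: T] f -> (forall w, g w <= f w <= h w) ->
  P.-integrable [set: T] (EFin \o g) -> P.-integrable [set: T] (EFin \o h) ->
  P.-integrable [set: T] (EFin \o f).
Proof.
move=> mf gfh ig ih.
apply: (@le_integrable _ _ _ _ _ _ _
  ((abse \o (EFin \o g)) \+ (abse \o (EFin \o h)))%E) => //.
- exact/measurable_EFinP.
- move=> w _ /=; rewrite !lee_fin.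
  have /andP[gf fh] := gfh w.
  rewrite [leRHS]ger0_norm ?addr_ge0// ler_norml.
  have := lerNnormlW (lexx `|g w|); have := ler_norm (h w).
  by have := normr_ge0 (g w); have := normr_ge0 (h w); lra.
- by apply: integrableD => //; exact: integrable_abse.
Qed.

(** The negative part of [f] is dominated by the absolute value of [g]. Since its integral is
    finite, the upper bound on the integral of [f] passes to the positive part. *)
Lemma integrable_lower_bound f g :
  measurable_fun [set: T] f -> (forall w, g w <= f w) ->
  P.-integrable [set: T] (EFin \o g) -> (\int[P]_w (f w)%:E < +oo)%E ->
  P.-integrable [set: T] (EFin \o f).
Proof.
move=> mf gf ig; rewrite integralE => foo.
have mEf : measurable_fun [set: T] (EFin \o f) by exact/measurable_EFinP.
have fneg : (\int[P]_w ((EFin \o f)^\-%E w) < +oo)%E.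
  have /integrableP[_] := ig; apply: le_lt_trans.
  apply: ge0_le_integral => //.
  - exact: measurable_funeneg.
  - by apply: measurableT_comp => //; case/integrableP: ig.
  - move=> w _; rewrite funenegE /= -EFin_max lee_fin ge_max normr_ge0 andbT.
    have := lerNnormlW (lexx `|g w|); have := gf w; lra.
have fpos : (\int[P]_w ((EFin \o f)^\+%E w) < +oo)%E.
  move: foo; rewrite lteBlDr ?ge0_fin_numE ?integral_ge0//.
  by move/lt_le_trans; apply; rewrite leey.
apply/integrableP; split => //.
under eq_integral do rewrite -/((abse \o (EFin \o f)) _) fune_abse.
rewrite ge0_integralD//; last 2 first.
- exact: measurable_funepos.
- exact: measurable_funeneg.
exact: lte_add_pinfty.
Qed.

End integrable.

(** * Jensen's inequality when E(Y | Z) = Z *)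

Section jensen.
Context d (T : measurableType d) (R : realType) (P : probability T R).
Variables (Y Z : T -> R) (phi : R -> R).
Hypotheses (iY : P.-integrable [set: T] (EFin \o Y))
  (iZ : P.-integrable [set: T] (EFin \o Z))
  (YZ : forall B : set R, measurable B ->
    (\int[P]_(w in Z @^-1` B) (Z w)%:E = \int[P]_(w in Z @^-1` B) (Y w)%:E)%E)
  (iphiY : P.-integrable [set: T] (EFin \o (phi \o Y))).

Let mZ : measurable_fun [set: T] Z.
Proof. by apply/measurable_EFinP; case/integrableP: iZ. Qed.

Let measurable_preimage (B : set R) : measurable B -> measurable (Z @^-1` B).
Proof. by move=> mB; rewrite -[_ @^-1` _]setTI; exact: mZ. Qed.

(** On an event generated by [Z], the variables [Z] and [Y] have equal integrals, hence so do their
    images under an affine map; the bound by [phi] is then applied to [Y]. *)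
Let integral_affine_le (a b : R) (B : set R) : measurable B ->
  (forall y, a * y + b <= phi y) ->
  (\int[P]_(w in Z @^-1` B) (a * Z w + b)%:E <=
   \int[P]_(w in Z @^-1` B) (phi (Y w))%:E)%E.
Proof.
move=> mB le_phi; have mA := measurable_preimage mB.
have iYA : P.-integrable (Z @^-1` B) (EFin \o Y) by exact: integrableS iY.
have iZA : P.-integrable (Z @^-1` B) (EFin \o Z) by exact: integrableS iZ.
rewrite integral_affine// YZ// -integral_affine//.
apply: le_integral => //.
- exact: integrable_affine.
- exact: integrableS iphiY.
- by move=> w _; rewrite lee_fin.
Qed.

(* Splitting the event according to which of the affine functions attains the
   maximum reduces Jensen's inequality for the maximum to the affine case. *)
Let integral_max_affine_le (a b : R^nat) (n : nat) (B : set R) :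
  (forall m y, a m * y + b m <= phi y) -> measurable B ->
  (\int[P]_(w in Z @^-1` B) (max_affine a b n (Z w))%:E <=
   \int[P]_(w in Z @^-1` B) (phi (Y w))%:E)%E.
Proof.
(* The event stays general in the induction, because the hypothesis is used on the part of [B] where
   the earlier maximum prevails. *)
move=> le_phi; elim: n B => [|n IHn] B mB; first exact: integral_affine_le.
pose L := [set x | max_affine a b n x < a n.+1 * x + b n.+1].
have mL : measurable L.
  rewrite -[L]setTI; apply: (measurable_fun_ltr _ _ _ (Y := [set true])) => //.
  - exact: measurable_max_affine.
  - exact: measurable_affine.
have mU : measurable (B `&` L) by exact: measurableI.
have mV : measurable (B `&` ~` L) by apply: measurableI => //; exact: measurableC.
have BE : Z @^-1` B = Z @^-1` (B `&` L) `|` Z @^-1` (B `&` ~` L).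
  by rewrite -preimage_setU -setIUr setUCr setIT.
have dis : [disjoint Z @^-1` (B `&` L) & Z @^-1` (B `&` ~` L)].
  by apply/disj_setPS => w [/= [_ ?] [_]].
rewrite BE !integral_setU//; do 1?exact: measurable_preimage.
- apply: leeD.
  + rewrite (eq_integral (fun w => (a n.+1 * Z w + b n.+1)%:E)); last first.
      by move=> w; rewrite inE /= => -[_ /ltW h]; rewrite max_r.
    exact: integral_affine_le.
  + rewrite (eq_integral (fun w => (max_affine a b n (Z w))%:E)); last first.
      by move=> w; rewrite inE /= => -[_ /negP]; rewrite -leNgt => h; rewrite max_l.
    exact: IHn.
- apply/measurable_funTS; case/integrableP: iphiY => + _; exact.
- apply/measurable_funTS/measurable_EFinP.
  exact: measurableT_comp (measurable_max_affine a b n.+1) mZ.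
Qed.

(** Monotone convergence carries the bound for finite maxima over to [phi]. Subtracting the first
    affine function makes the sequence nonnegative, and that function is integrable, so it can be
    added back. *)
Lemma conditional_jensen_integrable :
  @convex_function R R^o [set: R^o] phi ->
  P.-integrable [set: T] (EFin \o (phi \o Z)).
Proof.
move=> cphi; have [a [b [le_phi sup_phi]]] := convex_sup_affine cphi.
have mphiZ : measurable_fun [set: T] (phi \o Z).
  by apply: measurableT_comp mZ; exact: measurable_convex.
have iaZ := integrable_affine (a 0) (b 0) measurableT iZ.
apply: (integrable_lower_bound (g := fun w => a 0 * Z w + b 0)) => //.
pose g n w := (max_affine a b n (Z w) - (a 0 * Z w + b 0))%:E.
have g0 n w : (0 <= g n w)%E.
  rewrite lee_fin subr_ge0; exact: (nondecreasing_max_affine a b (Z w) (leq0n n)).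
have mM n : measurable_fun [set: T] (max_affine a b n \o Z).
  by apply: measurableT_comp mZ; exact: measurable_max_affine.
have iphiYoo := integrable_lty measurableT iphiY.
have iM n : P.-integrable [set: T] (EFin \o (max_affine a b n \o Z)).
  apply: (integrable_lower_bound (g := fun w => a 0 * Z w + b 0)) => //.
    by move=> w; exact: (nondecreasing_max_affine a b (Z w) (leq0n n)).
  apply: le_lt_trans iphiYoo.
  exact: (@integral_max_affine_le a b n setT).
have mg n : measurable_fun [set: T] (g n).
  apply/measurable_EFinP/measurable_funB; first exact: mM.
  by apply/measurable_EFinP; case/integrableP: iaZ.
(* [K] bounds the integrals of all the [g n] at once, and thus that of their limit. *)
pose K := (\int[P]_w (phi (Y w))%:E - \int[P]_w (a 0 * Z w + b 0)%:E)%E.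
have gK n : (\int[P]_w g n w <= K)%E.
  rewrite /g; under eq_integral do rewrite EFinB.
  rewrite integralB//; last exact: iM.
  by apply: leeB => //; exact: (@integral_max_affine_le a b n setT).
have limg w : limn (g ^~ w) = (phi (Z w) - (a 0 * Z w + b 0))%:E.
  apply/cvg_lim => //; apply: cvg_EFin; first by near=> n.
  rewrite [X in X @ _ --> _](_ : _ =
    fun n => max_affine a b n (Z w) - (a 0 * Z w + b 0))//.
  by apply: cvgB; [exact: cvg_max_affine|exact: cvg_cst].
have intK : (\int[P]_w (phi (Z w) - (a 0 * Z w + b 0))%:E <= K)%E.
  under eq_integral do rewrite -limg.
  rewrite monotone_convergence//; last first.
    move=> w _ m n mn; rewrite lee_fin lerB//; exact: nondecreasing_max_affine.
  apply: lime_le; last by near=> n; exact: gK.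
  apply: ereal_nondecreasing_is_cvgn => m n mn; apply: ge0_le_integral => //.
  by move=> w _; rewrite lee_fin lerB//; exact: nondecreasing_max_affine.
have Koo : (K < +oo)%E.
  by rewrite ltey_eq fin_numB !integrable_fin_num.
have iD : P.-integrable [set: T] (EFin \o (fun w => phi (Z w) - (a 0 * Z w + b 0))).
  apply/integrableP; split.
    apply/measurable_EFinP/measurable_funB => //.
    by apply/measurable_EFinP; case/integrableP: iaZ.
  under eq_integral do rewrite /= ger0_norm ?subr_ge0 ?le_phi//.
  exact: le_lt_trans Koo.
have -> : (\int[P]_w ((phi \o Z) w)%:E =
    \int[P]_w ((phi (Z w) - (a 0 * Z w + b 0))%:E + (a 0 * Z w + b 0)%:E))%E.
  by apply: eq_integral => w _; rewrite -EFinD subrK.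
by rewrite integralD// lte_add_pinfty ?integrable_lty.
Unshelve. all: by end_near.
Qed.

End jensen.

(** The identified set constrains centered variables, whereas [phi] is integrable along the
    uncentered outcome; translating [phi] by the mean reconciles the two. *)
Lemma convex_function_shift (R : realType) (phi : R -> R) (c : R) :
  @convex_function R R^o [set: R^o] phi ->
  @convex_function R R^o [set: R^o] (fun y => phi (y + c)).
Proof.
move=> cphi t x y xT yT.
have h : phi (t%:num * (x + c) + (1 - t%:num) * (y + c)) <=
    t%:num * phi (x + c) + (1 - t%:num) * phi (y + c).
  by apply: (convex_functionP cphi); [exact: ge0|exact: le1].
have e : t%:num * (x + c) + (1 - t%:num) * (y + c) =
    t%:num * (x : R) + (1 - t%:num) * (y : R) + c by ring.
by rewrite e in h; exact: h.
Qed.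

(** * Integrability of convex transforms *)

Section convex_integrable.
Context d (T : measurableType d) (R : realType) (P : probability T R).
Variables (phi : R -> R) (cphi : @convex_function R R^o [set: R^o] phi).
Implicit Types f g : T -> R.

(** An affine minorant of [phi] gives an integrable lower bound, so a finite expectation already
    means integrability. *)
Lemma convex_integrable f : P.-integrable [set: T] (EFin \o f) ->
  ('E_P[fun w => phi (f w)] < +oo)%E ->
  P.-integrable [set: T] (EFin \o (phi \o f)).
Proof.
move=> iF foo; have [a [b [le_phi _]]] := convex_sup_affine cphi.
apply: (integrable_lower_bound (g := fun w => a 0 * f w + b 0)) => //.
- apply: measurableT_comp; first exact: measurable_convex.
  by apply/measurable_EFinP; case/integrableP: iF.
- exact: integrable_affine.
- by move: foo; rewrite unlock.
Qed.

(** The transform of the midpoint lies between an affine minorant and the average of the two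
    transforms, both integrable. *)
Lemma convex_integrable_midpoint f g :
  P.-integrable [set: T] (EFin \o f) -> P.-integrable [set: T] (EFin \o g) ->
  P.-integrable [set: T] (EFin \o (phi \o f)) ->
  P.-integrable [set: T] (EFin \o (phi \o g)) ->
  P.-integrable [set: T] (EFin \o (fun w => phi (2^-1 * f w + 2^-1 * g w))).
Proof.
move=> iF ig iphif iphig.
have half (u v : T -> R) : P.-integrable [set: T] (EFin \o u) ->
    P.-integrable [set: T] (EFin \o v) ->
    P.-integrable [set: T] (EFin \o (fun w => 2^-1 * u w + 2^-1 * v w)).
  move=> iu iv.
  rewrite (_ : _ \o _ = ((fun w => 2^-1%:E * (EFin \o u) w) \+
                         (fun w => 2^-1%:E * (EFin \o v) w))%E)//.
  by apply: integrableD => //; exact: integrableZl.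
have [a [b [le_phi _]]] := convex_sup_affine cphi.
have ifg := half _ _ iF ig.
apply: (integrable_squeeze (g := fun w => a 0 * (2^-1 * f w + 2^-1 * g w) + b 0)
  (h := fun w => 2^-1 * (phi \o f) w + 2^-1 * (phi \o g) w)).
- apply: (measurableT_comp (measurable_convex cphi)).
  by apply/measurable_EFinP; case/integrableP: ifg.
- move=> w; rewrite le_phi/=.
  have -> : 2^-1 * g w = (1 - 2^-1) * g w by field.
  have -> : 2^-1 * phi (g w) = (1 - 2^-1) * phi (g w) by field.
  by apply: convex_functionP => //; lra.
- exact: integrable_affine.
- exact: half.
Qed.

End convex_integrable.

(** * Transfer between variables with the same law *)

Lemma eq_distribution_sym d1 d2 d' (T1 : measurableType d1)
    (T2 : measurableType d2) (S : measurableType d') (R : realType)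
    (P1 : probability T1 R) (P2 : probability T2 R)
    (X1 : {RV P1 >-> S}) (X2 : {RV P2 >-> S}) :
  eq_distribution X1 X2 -> eq_distribution X2 X1.
Proof. by move=> X12 B mB; rewrite X12. Qed.

(** The integral of the absolute value of [f] along a variable is an integral against its law, which
    depends only on the measure of measurable sets. *)
Lemma eq_distribution_integrable d1 d2 d' (T1 : measurableType d1)
    (T2 : measurableType d2) (S : measurableType d') (R : realType)
    (P1 : probability T1 R) (P2 : probability T2 R)
    (X1 : {RV P1 >-> S}) (X2 : {RV P2 >-> S}) (f : S -> R) :
  eq_distribution X1 X2 -> measurable_fun [set: S] f ->
  P1.-integrable [set: T1] (EFin \o (f \o X1)) ->
  P2.-integrable [set: T2] (EFin \o (f \o X2)).
Proof.
move=> X12 mf /integrableP[_ foo]; apply/integrableP; split.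
  by apply/measurable_EFinP; exact: measurableT_comp.
have mabs : measurable_fun [set: S] (fun x => `|f x|%:E).
  by apply/measurable_EFinP; exact: measurableT_comp.
move: foo; congr (_ < _)%E.
transitivity (\int[distribution P1 X1]_x `|f x|%:E)%E.
  by rewrite ge0_integral_pushforward// => x _; rewrite lee_fin.
transitivity (\int[distribution P2 X2]_x `|f x|%:E)%E.
  by apply: eq_measure_integral => A mA _; exact: X12.
by rewrite ge0_integral_pushforward// => x _; rewrite lee_fin.
Qed.

(** * Linear forms and centering *)

Section dot.
Context (R : realType) (n : nat).
Implicit Types (x : n.-tuple R) (b : 'cV[R]_n).

Lemma dotD x b b' : dot x (b + b') = dot x b + dot x b'.
Proof. by rewrite -big_split; apply: eq_bigr => i _; rewrite mxE mulrDr. Qed.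

Lemma dotZ x (c : R) b : dot x (c *: b) = c * dot x b.
Proof. by rewrite /dot mulr_sumr; apply: eq_bigr => i _; rewrite mxE mulrCA. Qed.

Lemma measurable_dot b : measurable_fun [set: n.-tuple R] (fun x => dot x b).
Proof.
apply: measurable_sum => i; apply: measurable_funM => //.
exact: measurable_tnth.
Qed.

End dot.

Lemma generated_sigma_preimage d d' (T : measurableType d)
    (S : measurableType d') (X : T -> S) (B : set S) :
  measurable B -> generated_sigma X (X @^-1` B).
Proof. by move=> mB; exists B => //; rewrite setTI. Qed.

(** This is E(X)'b, the constant by which centering shifts the linear form. *)
Definition mean_dot d (T : measurableType d) (R : realType)
    (P : probability T R) (n : nat) (X : T -> n.-tuple R) (b : 'cV[R]_n) : R :=
  \sum_(i < n) fine 'E_P[fun w => tnth (X w) i] * b i ord0.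

Lemma dot_centered d (T : measurableType d) (R : realType)
    (P : probability T R) (n : nat) (X : T -> n.-tuple R) (b : 'cV[R]_n) w :
  dot (centered_vec P X w) b = dot (X w) b - mean_dot P X b.
Proof.
rewrite /dot /mean_dot -sumrB; apply: eq_bigr => i _.
by rewrite tnth_mktuple mulrBl.
Qed.

(** * Elements of the identified set *)

Section linear_model.
Context d (T : measurableType d) (R : realType) (P : probability T R) (n : nat).
Variables (X : {RV P >-> n.-tuple R}) (Y : {RV P >-> R}).

Lemma integrable_coordinate i :
  ('E_P[(fun w => sqnorm (X w))%R] < +oo)%E ->
  P.-integrable [set: T] (EFin \o (fun w => tnth (X w) i)).
Proof.
have sqnorm_ge0 (x : n.-tuple R) : 0 <= sqnorm x.
  by apply: sumr_ge0 => j _; exact: sqr_ge0.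
have mX j : measurable_fun [set: T] (fun w => tnth (X w) j).
  exact: measurableT_comp (measurable_tnth j) _.
rewrite unlock => sq_oo.
have isq : P.-integrable [set: T] (EFin \o (fun w => sqnorm (X w))).
  apply/integrableP; split.
    apply/measurable_EFinP; apply: measurable_sum => j.
    exact: measurable_funX.
  by under eq_integral do rewrite /= (ger0_norm (sqnorm_ge0 _)).
(* Each coordinate [t] satisfies [|t| <= t ^+ 2 + 1], so the squared norm plus 1 dominates it. *)
apply: (integrable_squeeze (g := fun w => - 1 * sqnorm (X w) + (- 1))
  (h := fun w => 1 * sqnorm (X w) + 1)) => //; do 1?exact: integrable_affine.
move=> w; have : tnth (X w) i ^+ 2 <= sqnorm (X w).
  by rewrite /sqnorm (bigD1 i)//= lerDl sumr_ge0// => j _; exact: sqr_ge0.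
by move=> h; apply/andP; split; nra.
Qed.

Hypothesis iX : forall i, P.-integrable [set: T] (EFin \o (fun w => tnth (X w) i)).

Lemma integrable_dot b : P.-integrable [set: T] (EFin \o (fun w => dot (X w) b)).
Proof.
rewrite (_ : _ \o _ = fun w => \sum_(i < n) (b i ord0)%:E * (tnth (X w) i)%:E)%E.
  by apply: integrable_sum => // i _; exact: (integrableZl measurableT (b i ord0) (iX i)).
apply/funext => w /=; rewrite /dot -sumEFin; apply: eq_bigr => i _.
by rewrite -EFinM mulrC.
Qed.

Lemma integral_dot b : (\int[P]_w (dot (X w) b)%:E = (mean_dot P X b)%:E)%E.
Proof.
have -> : (\int[P]_w (dot (X w) b)%:E =
    \int[P]_w \sum_(i < n) (b i ord0)%:E * (tnth (X w) i)%:E)%E.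
  apply: eq_integral => w _; rewrite /dot -sumEFin; apply: eq_bigr => i _.
  by rewrite -EFinM mulrC.
rewrite integral_sum//; last by move=> i; exact: (integrableZl measurableT (b i ord0) (iX i)).
rewrite /mean_dot -sumEFin; apply: eq_bigr => i _.
rewrite (integralZl measurableT (iX i)).
by rewrite EFinM muleC unlock fineK// (integrable_fin_num measurableT (iX i)).
Qed.

(** The pair (X, Y) itself is the coupling. Taking expectations gives E(Y) = alpha0 + E(X)'beta0, so
    centering both sides of the regression eliminates [alpha0]. *)
Lemma identified_set_true_coefficient (alpha0 : R) (beta0 : 'cV[R]_n) :
  cond_expectation_eq P Y X (fun w => alpha0 + dot (X w) beta0) ->
  identified_set X Y beta0.
Proof.
move=> [iY iZ sZ YZ]; exists d, T, P, X, Y; split=> //.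
have iD := integrable_dot beta0.
have mean_Y : fine 'E_P[Y] = alpha0 + mean_dot P X beta0.
  rewrite unlock -YZ.
    under eq_integral do rewrite addrC -[dot _ _]mul1r.
    by rewrite integral_affine// mul1e integral_dot probability_setT mule1 addrC.
  by rewrite -[setT](preimage_setT X); exact: generated_sigma_preimage.
have Z0E w : dot (centered_vec P X w) beta0 =
    1 * dot (X w) beta0 + - mean_dot P X beta0.
  by rewrite dot_centered mul1r.
have Y0E w : centered P Y w = 1 * Y w + - (alpha0 + mean_dot P X beta0).
  by rewrite /centered mean_Y mul1r.
split.
- rewrite (_ : _ \o _ =
    EFin \o (fun w => 1 * Y w + - (alpha0 + mean_dot P X beta0))).
    exact: integrable_affine.
  by apply/funext => w /=; rewrite Y0E.
- rewrite (_ : _ \o _ =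
    EFin \o (fun w => 1 * dot (X w) beta0 + - mean_dot P X beta0)).
    exact: integrable_affine.
  by apply/funext => w /=; rewrite Z0E.
- move=> B mB.
  rewrite -[X in generated_sigma _ X]/(centered_vec P X @^-1`
    ((fun x => dot x beta0) @^-1` B)).
  apply: generated_sigma_preimage; rewrite -[_ @^-1` _]setTI.
  exact: measurable_dot.
- move=> _ [C mC <-]; rewrite setTI.
  (* Centering is the measurable translation [g] applied to [X]; events generated by the centered
     vector are therefore generated by [X], where the hypothesis applies. *)
  pose g (x : n.-tuple R) : n.-tuple R :=
    [tuple tnth x i - fine 'E_P[fun w => tnth (X w) i] | i < n].
  have mg : measurable_fun [set: n.-tuple R] g.
    apply/measurable_fun_tnthP => i.
    rewrite (_ : _ \o _ = fun x => tnth x i - fine 'E_P[fun w => tnth (X w) i]).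
      by apply: measurable_funB => //; exact: measurable_tnth.
    by apply/funext => x /=; rewrite tnth_mktuple.
  have mgC : measurable (g @^-1` C) by rewrite -[_ @^-1` _]setTI; exact: mg.
  set A := _ @^-1` C; have AE : A = X @^-1` (g @^-1` C) by [].
  have mA : measurable A.
    by rewrite AE -[_ @^-1` _]setTI; exact: (@measurable_funPT _ _ _ _ X).
  have sA : generated_sigma X A by rewrite AE; exact: generated_sigma_preimage.
  under eq_integral do rewrite Z0E.
  under [RHS]eq_integral do rewrite Y0E.
  have iDA : P.-integrable A (EFin \o (fun w => dot (X w) beta0)).
    exact: integrableS iD.
  have iYA : P.-integrable A (EFin \o Y) by exact: integrableS iY.
  rewrite integral_affine// [RHS]integral_affine// -YZ//.
  under [X in (_ = _ * X + _)%E]eq_integral do rewrite addrC -[dot _ _]mul1r.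
  rewrite integral_affine// !mul1e -[RHS]addeA; congr (_ + _)%E.
  by rewrite -muleDl ?fin_num_measure// -EFinD; congr (_%:E * _)%E; ring.
Qed.

(** Jensen's inequality is applied on the space of the coupling, and the result is carried back to
    [X] by equality of laws. The constant is c = E(Y') - E(X')'b. *)
Lemma identified_set_convex_integrable (phi : R -> R) (b : 'cV[R]_n) :
  @convex_function R R^o [set: R^o] phi ->
  P.-integrable [set: T] (EFin \o (phi \o Y)) ->
  identified_set X Y b ->
  exists c, P.-integrable [set: T] (EFin \o (fun w => phi (dot (X w) b + c))).
Proof.
move=> cphi iphiY [d' [T' [P' [X' [Y' [[iY0 iZ0 sZ0 YZ0] XX YY]]]]]].
pose m := fine 'E_P'[Y'].
have iphiY' : P'.-integrable [set: T'] (EFin \o (phi \o Y')).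
  apply: eq_distribution_integrable iphiY => //.
    exact: eq_distribution_sym.
  exact: measurable_convex.
have := conditional_jensen_integrable (phi := fun y => phi (y + m)) iY0 iZ0.
(* Events generated by the linear form are generated by the centered regressors, so the conditional
   mean identity holds on them. *)
move=> /(_ (fun B mB => YZ0 _ (sZ0 _ mB))).
have -> : ((fun y => phi (y + m)) \o centered P' Y') = phi \o Y'.
  by apply/funext => w /=; rewrite /centered subrK.
move=> /(_ iphiY' (convex_function_shift m cphi)) iphiZ.
exists (- mean_dot P' X' b + m).
apply: (eq_distribution_integrable
  (f := fun x => phi (dot x b + (- mean_dot P' X' b + m))) XX).
  apply: (measurableT_comp (measurable_convex cphi)).
  by apply: measurable_funD => //; exact: measurable_dot.
rewrite (_ : _ \o _ = EFin \o ((fun y => phi (y + m)) \o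
  (fun w => dot (centered_vec P' X' w) b)))//.
by apply/funext => w /=; rewrite dot_centered addrA.
Qed.

End linear_model.

(** * Collapse of the identified sets to zero *)

Theorem proposition1 (R : realType) (d : measure_display)
    (T : measurableType d) (P : probability T R) (q : nat)
    (X : {RV P >-> q.+1.-tuple R}) (Y : {RV P >-> R})
    (alpha0 : R) (beta0 : 'cV[R]_q.+1) (phi : R -> R)
    (hY2 : ('E_P[(fun w => Y w ^+ 2)%R] < +oo)%E)
    (hX2 : ('E_P[(fun w => sqnorm (X w))%R] < +oo)%E)
    (hVY : (0 < 'V_P[Y])%E)
    (hVX : covariance_mx P X \in unitmx)
    (hYX : cond_expectation_eq P Y X (fun w => alpha0 + dot (X w) beta0))
    (hphi : @convex_function R R^o [set: R^o] phi)
    (hphiY : ('E_P[(fun w => phi (Y w))%R] < +oo)%E) :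
  ((forall b : 'cV[R]_q.+1, b != 0 ->
      ('E_P[(fun w => phi (dot (X w) b))%R] = +oo)%E) ->
    identified_set X Y = [set beta0] /\ [set beta0] = [set 0])
  /\
  ((forall b1 : R, b1 != 0 ->
      ('E_P[(fun w => phi (thead (X w) * b1))%R] = +oo)%E) ->
   (forall b' : 'cV[R]_q,
      ('E_P[(fun w => phi (dot [tuple of behead (X w)] b'))%R] < +oo)%E) ->
    identified_set1 X Y = [set beta0 ord0 ord0] /\
    [set beta0 ord0 ord0] = [set 0]).
Proof.
have iX i := integrable_coordinate i hX2.
have iY : P.-integrable [set: T] (EFin \o Y) by case: hYX.
have iphiY := convex_integrable hphi iY hphiY.
have beta0_id := identified_set_true_coefficient iX hYX.
(* [x / 2] is the midpoint of [x + c] and [- c], so the centering constant [c]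
   disappears at the cost of halving [b]. *)
have half b : identified_set X Y b ->
    P.-integrable [set: T] (EFin \o (fun w => phi (dot (X w) (2^-1 *: b)))).
  move=> /(identified_set_convex_integrable hphi iphiY)[c iphic].
  have iDc : P.-integrable [set: T] (EFin \o (fun w => dot (X w) b + c)).
    rewrite (_ : _ \o _ = EFin \o (fun w => 1 * dot (X w) b + c)).
      by apply: integrable_affine => //; exact: integrable_dot.
    by apply/funext => w /=; rewrite mul1r.
  have icst (r : R) : P.-integrable [set: T] (EFin \o cst r).
    exact: finite_measure_integrable_cst.
  have := convex_integrable_midpoint hphi iDc (icst (- c)) iphic (icst (phi (- c))).
  congr (_.-integrable _ _); apply/funext => w /=; congr (phi _)%:E.
  by rewrite dotZ -mulrDr addrK.
have not_infinite b :
    P.-integrable [set: T] (EFin \o (fun w => phi (dot (X w) b))) ->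
    ('E_P[(fun w => phi (dot (X w) b))%R] <> +oo)%E.
  by move=> ib; apply/eqP; rewrite -ltey unlock; exact: (integrable_lty measurableT ib).
split=> [hinf|h1inf hfin].
- have zero b : identified_set X Y b -> b = 0.
    move=> /half ib; apply: contrapT => /eqP b0.
    apply: not_infinite ib _; apply: hinf.
    by rewrite scaler_eq0 negb_or b0 invr_eq0 pnatr_eq0.
  have beta0_0 := zero _ beta0_id; rewrite beta0_0 in beta0_id *.
  by split=> //; apply/seteqP; split=> b /= => [/zero|->].
(* These columns translate the hypotheses on the first and on the remaining regressors into
   statements about linear forms in the whole of [X]. *)
- pose head_col (r : R) : 'cV[R]_q.+1 := \col_i (if i == ord0 then r else 0).
  pose tail_col (b : 'cV[R]_q.+1) : 'cV[R]_q := \col_i b (lift ord0 i) ord0.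
  have dot_head w r : dot (X w) (head_col r) = thead (X w) * r.
    rewrite /dot big_ord_recl big1 ?addr0; first by rewrite mxE.
    by move=> i _; rewrite mxE mulr0.
  have dot_tail w b : dot [tuple of behead (X w)] (tail_col b) =
      dot (X w) (b - head_col (b ord0 ord0)).
    rewrite /dot big_ord_recl !mxE/= subrr mulr0 add0r; apply: eq_bigr => i _.
    by rewrite !mxE/= subr0 [in RHS](tuple_eta (X w)) tnthS.
  have zero b : identified_set X Y b -> b ord0 ord0 = 0.
    move=> /half ib; apply: contrapT => /eqP b0.
    (* The first entry of [b'] is 0 and the others are those of [- b / 2], so the midpoint of
       [b / 2] and [b'] keeps only the first entry, [b_1 / 4]. *)
    pose b' := 2^-1 *: (head_col (b ord0 ord0) - b).
    have ib' : P.-integrable [set: T] (EFin \o (fun w => phi (dot (X w) b'))).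
      apply: (convex_integrable hphi (integrable_dot iX b')).
      (* As the first entry of [b'] vanishes, the column subtracted in [dot_tail] is zero and the
         hypothesis on the remaining regressors covers [b']. *)
      have := hfin (tail_col b'); congr (_ < _)%E.
      congr expectation; apply/funext => w; rewrite dot_tail.
      congr (phi (dot _ _)); rewrite /b' !mxE/= subrr mulr0.
      by apply/matrixP => i j; rewrite !mxE if_same subr0.
    have := convex_integrable_midpoint hphi (integrable_dot iX (2^-1 *: b))
      (integrable_dot iX b') ib ib'.
    have -> : (fun w => phi (2^-1 * dot (X w) (2^-1 *: b) + 2^-1 * dot (X w) b')) =
        (fun w => phi (dot (X w) (head_col (4^-1 * b ord0 ord0)))).
      apply/funext => w; congr phi; rewrite -!dotZ -dotD; congr dot.
      apply/matrixP => i j; rewrite !mxE.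
      by case: ifP => [/eqP ->|_]; rewrite ?(ord1 j); field.
    move/not_infinite; apply; under eq_fun do rewrite dot_head.
    by apply: h1inf; rewrite mulf_neq0// invr_eq0 pnatr_eq0.
  rewrite (zero _ beta0_id); split=> //; apply/seteqP; split=> r /=.
    by move=> [b /zero-> ->].
  (* The identified set contains [beta0], so the value 0 is attained. *)
  by move=> ->; exists beta0 => //; exact: zero.
Qed.
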